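(* Let $X$ be an infinite set. The diagonal right act and the diagonal left act of both the partition monoid $\mathcal P_X$ and the partial Brauer monoid $\mathcal{PB}_X$ are monogenic. Consequently, both $\mathcal P_X$ and $\mathcal{PB}_X$ have right diameter $1$ and left diameter $1$.
   Context: Partition monoids. Let $X'=\{x':x\in X\}$ be a disjoint copy of $X$. $\mathcal P_X$ consists of all set partitions of $X\cup X'$ (into non-empty blocks). For $\alpha,\beta\in\mathcal P_X$, let $X''=\{x'':x\in X\}$ be a further disjoint copy of $X$; represent a partition by a graph whose connected components are its blocks; let $\alpha_\downarrow$ be the graph obtained from $\alpha$ by replacing every $x'$ by $x''$, and $\beta^\uparrow$ the graph obtained from $\beta$ by replacing every $x$ by $x''$. The product graph $\Pi(\alpha,\beta)$ has vertex set $X\cup X''\cup X'$ and edge set the union of the edge sets of $\alpha_\downarrow$ and $\beta^\uparrow$. The product $\alpha\beta$ is the partition of $X\cup X'$ in which $u,v\in X\cup X'$ are in the same block if and only if they are in the same connected component of $\Pi(\alpha,\beta)$. This makes $\mathcal P_X$ a monoid with identity $\{\{x,x'\}:x\in X\}$. $\mathcal{PB}_X$ is the submonoid of all partitions whose blocks all have size at most $2$. Diagonal acts. For a semigroup $S$, $S^1$ is $S$ with an identity adjoined if $S$ has none ($S^1=S$ if $S$ is a monoid). The diagonal right $S$-act is the set $S\times S$ with right action $(a,b)c=(ac,bc)$; it is monogenic if $S\times S=(u,v)S^1$ for some $(u,v)\in S\times S$. The diagonal left $S$-act is $S\times S$ with left action $c(a,b)=(ca,cb)$; it is monogenic if $S\times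 S=S^1(u,v)$ for some $(u,v)\in S\times S$. Diameter. A right congruence on $S$ is an equivalence relation $\rho$ such that $(a,b)\in\rho$ implies $(as,bs)\in\rho$ for all $s\in S$; $\langle U\rangle$ denotes the smallest right congruence containing $U\subseteq S\times S$. The universal relation viewed as a right congruence is $\omega_S^r$; it is finitely generated if $\omega_S^r=\langle U\rangle$ for some finite $U$. A $U$-sequence of length $n\geq 1$ from $a$ to $b$ is a sequence $a=u_1s_1,\ v_1s_1=u_2s_2,\ \dots,\ v_ns_n=b$ where, for each $i$, $(u_i,v_i)\in U$ or $(v_i,u_i)\in U$, and $s_i\in S^1$; if $a=b$ then $a,b$ are related by a $U$-sequence of length $0$. If $\omega_S^r=\langle U\rangle$, let $d_U^r(a,b)$ be the least length of a $U$-sequence from $a$ to $b$ and $D_r(U,S)=\sup\{d_U^r(a,b):a,b\in S\}$. If $\omega_S^r$ is finitely generated, the right diameter of $S$ is $D_r(S)=\min\{D_r(U,S): \omega_S^r=\langle U\rangle,\ U\text{ finite}\}$. ''$S$ has right diameter $n$'' means $\omega_S^r$ is finitely generated and $D_r(S)=n$. Left diameter is defined in the left-right dual manner, with left congruences and sequences $a=s_1u_1,\ s_1v_1=s_2u_2,\ \dots,\ s_nv_n=b$. *)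

(* Defs.v *)
From HB Require Import structures.
From Stdlib Require Import Relation_Operators.
From mathcomp Require Import all_boot all_order.
From mathcomp Require Import boolp classical_sets functions cardinality.

Set Implicit Arguments.
Unset Strict Implicit.
Unset Printing Implicit Defensive.

Local Open Scope classical_set_scope.

(* X `|` X' is modelled by X + X: inl x stands for x, and inr x for x'. *)
Record Pmon (X : Type) := MkPmon {
  blocks : set (set (X + X));
  blocks_partition : partition blocks id [set: X + X] }.

Definition same_block (X : Type) (a : Pmon X) (u v : X + X) : Prop :=
  exists2 B, blocks a B & B u /\ B v.

(* Vertices x, x'' and x' of the product graph. *)
Inductive pvertex (X : Type) : Type :=
  | Upper of X
  | Middle of X
  | Lower of X.

Definition lower_to_middle (X : Type) (u : X + X) : pvertex X :=
  match u with inl x => Upper x | inr x => Middle x end.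

Definition upper_to_middle (X : Type) (u : X + X) : pvertex X :=
  match u with inl x => Middle x | inr x => Lower x end.

Definition outer (X : Type) (u : X + X) : pvertex X :=
  match u with inl x => Upper x | inr x => Lower x end.

(* A partition is represented by the graph that is complete on each block; any
   other graph with the same components yields the same product. *)
Inductive pedge (X : Type) (a b : Pmon X) : pvertex X -> pvertex X -> Prop :=
  | pedge_down u v : same_block a u v ->
      pedge a b (lower_to_middle u) (lower_to_middle v)
  | pedge_up u v : same_block b u v ->
      pedge a b (upper_to_middle u) (upper_to_middle v).

Definition connected_by (V : Type) (e : V -> V -> Prop) : V -> V -> Prop :=
  clos_refl_sym_trans V e.

Definition pmul_blocks (X : Type) (a b : Pmon X) : set (set (X + X)) :=
  range (fun u => [set v | connected_by (pedge a b) (outer u) (outer v)]).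

Definition pone_blocks (X : Type) : set (set (X + X)) :=
  range (fun x => [set inl x; inr x]).

Section Connected.
Variables (V : Type).
Implicit Types e : V -> V -> Prop.

Lemma connE e x y : e x y -> connected_by e x y. Proof. exact: rst_step. Qed.
Lemma connR e x : connected_by e x x. Proof. exact: rst_refl. Qed.
Lemma connS e x y : connected_by e x y -> connected_by e y x.
Proof. exact: rst_sym. Qed.
Lemma connT e y x z :
  connected_by e x y -> connected_by e y z -> connected_by e x z.
Proof. exact: rst_trans. Qed.

Lemma conn_min e (r : V -> V -> Prop) :
  (forall x, r x x) -> (forall x y, r x y -> r y x) ->
  (forall x y z, r x y -> r y z -> r x z) ->
  (forall x y, e x y -> r x y) -> forall x y, connected_by e x y -> r x y.
Proof.
move=> rr rs rt er x y; elim=> {x y} [x y /er//|//|x y _ /rs//|x y z _ h _].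
exact: rt.
Qed.

Lemma conn_closed e (P : V -> Prop) :
  (forall x y, e x y -> P x <-> P y) ->
  forall x y, connected_by e x y -> P x -> P y.
Proof.
move=> eP x y xy; suff: P x <-> P y by case.
by move: x y xy; apply: conn_min eP => // [x y ->//|x y z -> ->].
Qed.

(* Elimination of the vertices outside K. *)
Lemma conn_elim (R S : V -> V -> Prop) (K : V -> Prop) :
  (forall x y, R x y -> R y x) -> (forall x y, S x y -> S y x) ->
  (forall x y, S x y -> K x /\ K y) ->
  forall u v, K u -> K v ->
  connected_by (fun x y => R x y \/ S x y) u v <->
  connected_by (fun x y => [/\ K x, K y & connected_by R x y] \/ S x y) u v.
Proof.
move=> Rs Ss SK u v Ku Kv; split; last first.
  apply: conn_min => [x|x y|x y z|x y]; [exact: connR|exact: connS|exact: connT|].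
  case=> [[_ _]|Sxy]; last by apply: connE; right.
  apply: conn_min => [z|z t|z t w|z t Rzt];
    [exact: connR|exact: connS|exact: connT|by apply: connE; left].
set E := (fun x y => [/\ _, _ & _] \/ _) => uv.
pose P x := exists y, [/\ K y, connected_by E u y & connected_by R y x].
have PR x y : R x y -> P x -> P y.
  move=> Rxy [z [Kz uz zx]]; exists z; split=> //.
  by apply: connT zx _; apply: connE.
have PS x y : S x y -> P x -> P y.
  move=> Sxy [z [Kz uz zx]]; have [Kx Ky] := SK _ _ Sxy.
  exists y; split=> //; last exact: connR.
  apply: connT uz _; apply: (@connT _ x); apply: connE; last by right.
  by left; split.
have [z [Kz uz zv]] : P v.
  apply: conn_closed uv _; last by exists u; split=> //; exact: connR.
  move=> x y [Rxy|Sxy]; split.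
  - exact: PR.
  - by apply: PR; apply: Rs.
  - exact: PS.
  - by apply: PS; apply: Ss.
by apply: connT uz _; apply: connE; left; split.
Qed.

End Connected.

Lemma conn_map (V W : Type) (f : V -> W) (e : V -> V -> Prop)
    (e' : W -> W -> Prop) :
  (forall x y, e x y -> connected_by e' (f x) (f y)) ->
  forall x y, connected_by e x y -> connected_by e' (f x) (f y).
Proof.
move=> ee'; apply: (@conn_min _ _ (fun x y => connected_by e' (f x) (f y))) => //.
- by move=> x; exact: connR.
- by move=> x y; exact: connS.
- by move=> x y z; exact: connT.
Qed.

Lemma conn_inj (V W : Type) (f : V -> W) (e : V -> V -> Prop)
    (e' : W -> W -> Prop) :
  injective f ->
  (forall x y, e' x y -> exists p q, [/\ x = f p, y = f q & e p q]) ->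
  forall p y, connected_by e' (f p) y ->
    exists2 q, y = f q & connected_by e p q.
Proof.
move=> fI e'E p y py.
apply: (conn_closed (P := fun z => exists2 q, z = f q & connected_by e p q) _ py).
  move=> x z /e'E[q [r [-> -> qr]]]; split=> -[s /fI <- ps].
    by exists r => //; apply: connT ps _; apply: connE.
  by exists q => //; apply: connT ps _; apply: connS; apply: connE.
by exists p => //; exact: connR.
Qed.

Section PmonTheory.
Variable X : Type.
Implicit Types (a b c : Pmon X) (u v w : X + X).

Lemma same_block_refl a u : same_block a u u.
Proof.
have [cov _ _] := blocks_partition a.
have : [set: X + X] u by []. by rewrite -cov => -[B aB Bu]; exists B.
Qed.

Lemma same_block_sym a u v : same_block a u v -> same_block a v u.
Proof. by move=> [B aB [Bu Bv]]; exists B. Qed.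

Lemma block_eq a B C u : blocks a B -> blocks a C -> B u -> C u -> B = C.
Proof.
have [_ triv _] := blocks_partition a.
by move=> aB aC Bu Cu; apply: triv => //; exists u.
Qed.

Lemma same_block_trans a v u w :
  same_block a u v -> same_block a v w -> same_block a u w.
Proof.
move=> [B aB [Bu Bv]] [C aC [Cv Cw]]; exists B => //; split=> //.
by rewrite (block_eq aB aC Bv Cv).
Qed.

Lemma Pmon_blocks_inj : injective (@blocks X).
Proof.
by move=> [p pP] [q qP] /= pq; move: pP qP; rewrite pq => pP qP; congr MkPmon.
Qed.

Lemma Pmon_eq a b :
  (forall u v, same_block a u v <-> same_block b u v) -> a = b.
Proof.
suff sub c d : (forall u v, same_block c u v <-> same_block d u v) ->
    blocks c `<=` blocks d.
  move=> ab; apply: Pmon_blocks_inj; apply/seteqP; split; apply: sub => //.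
  by move=> u v; rewrite ab.
move=> cd B cB; have [_ _ /(_ B cB)[u Bu]] := blocks_partition c.
have [D dD [Du _]] := same_block_refl d u.
suff -> : B = D by [].
apply/seteqP; split=> v Pv.
  have /cd[C dC [Cu Cv]] : same_block c u v by exists B.
  by rewrite (block_eq dD dC Du Cu).
have /cd[C cC [Cu Cv]] : same_block d u v by exists D.
by rewrite (block_eq cB cC Bu Cu).
Qed.

Lemma pmul_partition a b : partition (pmul_blocks a b) id [set: X + X].
Proof.
split=> [|B C [u _ <-] [v _ <-] [w [uw vw]]|B [u _ <-]].
- apply/seteqP; split=> // u _.
  by exists [set v | connected_by (pedge a b) (outer u) (outer v)];
    [exists u|exact: connR].
- apply/seteqP; split=> z.
    by apply: connT; apply: connT vw _; exact: connS.
  by apply: connT; apply: connT uw _; exact: connS.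
- by exists u; exact: connR.
Qed.

Lemma pone_partition : partition (@pone_blocks X) id [set: X + X].
Proof.
split=> [|B C [x _ <-] [y _ <-] [w [/= xw yw]]|B [x _ <-]].
- by apply/seteqP; split=> // -[] x _; exists [set inl x; inr x];
    [exists x|left|exists x|right].
- by have -> : x = y by case: xw yw => -> [] // [].
- by exists (inl x); left.
Qed.

Definition pmul a b : Pmon X := MkPmon (pmul_partition a b).
Definition pone : Pmon X := MkPmon pone_partition.

Lemma same_block_mul a b u v :
  same_block (pmul a b) u v <-> connected_by (pedge a b) (outer u) (outer v).
Proof.
split=> [[B [w _ <-] [wu wv]]|uv]; first exact: connT (connS wu) wv.
exists [set v | connected_by (pedge a b) (outer u) (outer v)]; first by exists u.
by split=> //; exact: connR.
Qed.

Lemma same_block_one x : same_block pone (inl x) (inr x).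
Proof. by exists [set inl x; inr x]; [exists x|split; [left|right]]. Qed.

Lemma same_block_oneP u v : same_block pone u v ->
  match u with inl x => x | inr x => x end =
  match v with inl x => x | inr x => x end.
Proof. by case=> B [x _ <-] [[->|->] [->|->]]. Qed.

Lemma pmul1g : left_id pone pmul.
Proof.
move=> b; apply: Pmon_eq => u v; rewrite same_block_mul; split.
  pose f (p : pvertex X) : X + X :=
    match p with Upper x => inl x | Middle x => inl x | Lower x => inr x end.
  have fK w : f (outer w) = w by case: w.
  rewrite -{2}(fK u) -{2}(fK v).
  apply: (@conn_min _ _ (fun p q => same_block b (f p) (f q))).
  - by move=> p; exact: same_block_refl.
  - by move=> p q; exact: same_block_sym.
  - by move=> p q r; exact: same_block_trans.
  - move=> _ _ [s t /same_block_oneP st|s t].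
      have -> : f (lower_to_middle s) = f (lower_to_middle t).
        by case: s st => x; case: t => y /= ->.
      exact: same_block_refl.
    by case: s => x; case: t.
have ext w : connected_by (pedge pone b) (outer w) (upper_to_middle w).
  case: w => x; last exact: connR.
  by apply: connE; apply: (pedge_down _ (same_block_one x)).
move=> uv; apply: connT (ext u) (connT _ (connS (ext v))).
by apply: connE; exact: pedge_up.
Qed.

Lemma pmulg1 : right_id pone pmul.
Proof.
move=> a; apply: Pmon_eq => u v; rewrite same_block_mul; split.
  pose f (p : pvertex X) : X + X :=
    match p with Upper x => inl x | Middle x => inr x | Lower x => inr x end.
  have fK w : f (outer w) = w by case: w.
  rewrite -{2}(fK u) -{2}(fK v).
  apply: (@conn_min _ _ (fun p q => same_block a (f p) (f q))).
  - by move=> p; exact: same_block_refl.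
  - by move=> p q; exact: same_block_sym.
  - by move=> p q r; exact: same_block_trans.
  - move=> _ _ [s t|s t /same_block_oneP st]; first by case: s => x; case: t.
    have -> : f (upper_to_middle s) = f (upper_to_middle t).
      by case: s st => x; case: t => y /= ->.
    exact: same_block_refl.
have ext w : connected_by (pedge a pone) (outer w) (lower_to_middle w).
  case: w => x; first exact: connR.
  by apply: connS; apply: connE; apply: (pedge_up _ (same_block_one x)).
move=> uv; apply: connT (ext u) (connT _ (connS (ext v))).
by apply: connE; exact: pedge_down.
Qed.

(* For associativity, copies of X indexed by 0, 1, 2, 3 carry the graphs of
   three partitions. *)
Definition level (i j : nat) u : nat * X :=
  match u with inl x => (i, x) | inr x => (j, x) end.

Definition plevel (i j k : nat) (p : pvertex X) : nat * X :=
  match p with Upper x => (i, x) | Middle x => (j, x) | Lower x => (k, x) end.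

Definition ledge (i j : nat) a (p q : nat * X) : Prop :=
  exists u v, [/\ p = level i j u, q = level i j v & same_block a u v].

Lemma ledge_sym i j a p q : ledge i j a p q -> ledge i j a q p.
Proof.
by move=> [u [v [-> -> uv]]]; exists v, u; split=> //; exact: same_block_sym.
Qed.

Lemma ledge_level i j a p q :
  ledge i j a p q -> (p.1 = i \/ p.1 = j) /\ (q.1 = i \/ q.1 = j).
Proof.
by move=> [[]x [[]y [-> -> _]]] /=; split; by [left | right].
Qed.

Lemma conn_ledge i j k a b : i <> j -> j <> k -> i <> k -> forall p q,
  connected_by (fun p q => ledge i j a p q \/ ledge j k b p q)
    (plevel i j k p) q <->
  exists2 r, q = plevel i j k r & connected_by (pedge a b) p r.
Proof.
move=> ij jk ik p q; split; last first.
  move=> [r ->]; apply: conn_map => _ _ [u v uv|u v uv]; apply: connE.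
    by left; exists u, v; split=> //; [case: (u)|case: (v)].
  by right; exists u, v; split=> //; [case: (u)|case: (v)].
apply: conn_inj => [|x y [] [u [v [-> -> uv]]]].
- by move=> [] x [] y /=; congruence.
- exists (lower_to_middle u), (lower_to_middle v).
  by split; [case: u {uv}|case: v {uv}|exact: pedge_down].
- exists (upper_to_middle u), (upper_to_middle v).
  by split; [case: u {uv}|case: v {uv}|exact: pedge_up].
Qed.

Lemma conn_ledge_outer i j k a b : i <> j -> j <> k -> i <> k -> forall u v,
  connected_by (fun p q => ledge i j a p q \/ ledge j k b p q)
    (level i k u) (level i k v) <-> same_block (pmul a b) u v.
Proof.
move=> ij jk ik u v; rewrite same_block_mul.
have outE w : level i k w = plevel i j k (outer w) by case: w.
rewrite !outE conn_ledge //; split=> [[r]|]; last by exists (outer v).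
suff I : outer v = r \/ plevel i j k (outer v) <> plevel i j k r.
  by case: I => [->|].
case: v r => x [] y /=; do ?[by right; case => /esym; auto | by right; case];
  by have [->|xy] := pselect (x = y); [left|right; case].
Qed.

(* The middle level j of the first pair of partitions is eliminated. *)
Lemma conn_ledge_mul i j k (P : nat -> Prop) a b (S : nat * X -> nat * X -> Prop) :
  i <> j -> j <> k -> i <> k -> P i -> P k -> ~ P j ->
  (forall p q, S p q -> S q p) -> (forall p q, S p q -> P p.1 /\ P q.1) ->
  forall p q, P p.1 -> P q.1 ->
  connected_by (fun p q => (ledge i j a p q \/ ledge j k b p q) \/ S p q) p q <->
  connected_by (fun p q => ledge i k (pmul a b) p q \/ S p q) p q.
Proof.
move=> ij jk ik Pi Pk Pj Ss SP p q Pp Pq.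
rewrite (@conn_elim _ _ _ (fun x => P x.1)) //; last first.
  by move=> x y [/ledge_sym|/ledge_sym]; [left|right].
split; apply: conn_min => [x|x y|x y z|x y];
    do ?[exact: connR|exact: connS|exact: connT]; last first.
  case=> [|Sxy]; last by apply: connE; right.
  case=> u [v [-> -> uv]]; apply: connE; left; split.
  - by case: (u).
  - by case: (v).
  - by apply/conn_ledge_outer.
case=> [[Px Py xy]|Sxy]; last by apply: connE; right.
have Pout z : P z.1 -> forall p, z = plevel i j k p -> exists u, z = level i k u.
  by move=> + [] t zE; rewrite zE => // _; [exists (inl t)|exists (inr t)].
have [[u xE]|nx] := pselect (exists u, x = level i k u).
  have [r yE _] : exists2 r, y = plevel i j k r &
      connected_by (pedge a b) (outer u) r.
    by apply/conn_ledge => //; have -> : plevel i j k (outer u) = x by rewrite xE; case: (u).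
  have [v yE'] := Pout _ Py _ yE.
  apply: connE; left; exists u, v; split=> //.
  by apply/(@conn_ledge_outer i j k) => //; rewrite -xE -yE'.
suff -> : y = x by exact: connR.
apply: (conn_closed (P := fun z => z = x) _ xy) => // s t.
have nlev z : z.1 = i \/ z.1 = j \/ z.1 = k -> z <> x.
  move=> + zx; rewrite zx => -[xi|[xj|xk]].
  - by apply: nx; exists (inl x.2); rewrite /= -xi; case: (x).
  - by apply: Pj; rewrite -xj.
  - by apply: nx; exists (inr x.2); rewrite /= -xk; case: (x).
by move=> st; split=> E; exfalso; move: E; apply: nlev; case: st => /ledge_level;
  intuition.
Qed.

Lemma pmulgA : associative pmul.
Proof.
move=> a b c; apply: Pmon_eq => u v.
rewrite -(@conn_ledge_outer 0 1 3) // -(@conn_ledge_outer 0 2 3 (pmul a b)) //.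
have lev w : (level 0 3 w).1 <> 1 /\ (level 0 3 w).1 <> 2 by case: w.
rewrite -(@conn_ledge_mul 0 1 2 (fun i => i <> 1) a b (ledge 2 3 c)) //; try by
  [ exact: (lev _).1 | move=> p q; exact: ledge_sym | move/(_ erefl)
  | move=> p q /ledge_level [[->|->] [->|->]] ].
have E : (fun p q => ledge 0 1 a p q \/ ledge 1 3 (pmul b c) p q) =
         (fun p q => ledge 1 3 (pmul b c) p q \/ ledge 0 1 a p q).
  by apply/funext => p; apply/funext => q; rewrite propeqE; split=> -[]; auto.
rewrite E -(@conn_ledge_mul 1 2 3 (fun i => i <> 2) b c (ledge 0 1 a)) //; try by
  [ exact: (lev _).2 | move=> p q; exact: ledge_sym | move/(_ erefl)
  | move=> p q /ledge_level [[->|->] [->|->]] ].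
suff -> : (fun p q => (ledge 1 2 b p q \/ ledge 2 3 c p q) \/ ledge 0 1 a p q) =
  (fun p q => (ledge 0 1 a p q \/ ledge 1 2 b p q) \/ ledge 2 3 c p q) by [].
by apply/funext => p; apply/funext => q; rewrite propeqE; tauto.
Qed.

End PmonTheory.

HB.instance Definition _ (X : Type) := gen_eqMixin (Pmon X).
HB.instance Definition _ (X : Type) := gen_choiceMixin (Pmon X).
HB.instance Definition _ (X : Type) :=
  isMonoid.Build (Pmon X) (@pmulgA X) (@pmul1g X) (@pmulg1 X).

Definition partial_brauer (X : Type) : {pred Pmon X} :=
  fun a => `[< forall B, blocks a B -> (B #<= `I_2)%card >].

Lemma card_le2P (T : Type) (B : set T) : (B #<= `I_2)%card <->
  forall x y z, B x -> B y -> B z -> x = y \/ y = z \/ x = z.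
Proof.
split=> [/pcard_leP/injfunPex[f fS fI] x y z Bx By Bz|B2].
  have fE s t : B s -> B t -> f s = f t -> s = t.
    by move=> Bs Bt; apply: fI; rewrite inE.
  have [/= fx fy fz] := And3 (fS x Bx) (fS y By) (fS z Bz).
  move: (fE x y Bx By) (fE y z By Bz) (fE x z Bx Bz).
  move: (f x) (f y) (f z) fx fy fz => [|[|?]] // [|[|?]] // [|[|?]] //;
    by auto.
have [[x Bx]|B0] := pselect (exists x, B x); last first.
  suff -> : B = set0 by exact: card_ge0.
  by apply/seteqP; split=> // x Bx; apply: B0; exists x.
have [y By] : exists y, B `<=` [set x; y].
  have [[y [By yx]]|Bx1] := pselect (exists y, B y /\ y <> x).
    by exists y => z Bz; have [/esym/yx|[]] := B2 x y z Bx By Bz; [|right|left].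
  by exists x => z Bz; left; apply: contrapT => zx; apply: Bx1; exists z.
apply: card_le_trans (subset_card_le By) _.
have -> : [set x; y] = (fun i => if i == 0 then x else y) @` `I_2.
  apply/seteqP; split=> [z [->|->]|z [[|i] _ <-]];
    by [exists 0|exists 1|left|right].
exact: card_image_le.
Qed.

Lemma partial_brauerP (X : Type) (a : Pmon X) :
  reflect (forall u v w, same_block a u v -> same_block a u w ->
             u = v \/ v = w \/ u = w)
          (a \in @partial_brauer X).
Proof.
apply: (iffP (asboolP _)) => [a2 u v w [B aB [Bu Bv]] [C aC [Cu Cw]]|a2 B aB].
  have BC := block_eq aB aC Bu Cu; subst C.
  exact: (card_le2P B).1 (a2 B aB) _ _ _ Bu Bv Cw.
by apply/card_le2P => x y z Bx By Bz; apply: a2; exists B.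
Qed.

(* In the product graph of two partial Brauer partitions, the component of an
   outer vertex u is a path, traversed from u by alternately following edges of
   the two partitions. *)
Section PartialBrauerMul.
Variables (X : Type) (a b : Pmon X).
Hypotheses (a2 : a \in @partial_brauer X) (b2 : b \in @partial_brauer X).
Implicit Types (u v w : X + X) (p q r : pvertex X) (i j : bool).

Let edge i p q : Prop :=
  if i then exists u v, [/\ p = lower_to_middle u, q = lower_to_middle v &
                            same_block a u v]
  else exists u v, [/\ p = upper_to_middle u, q = upper_to_middle v &
                       same_block b u v].

Let edge_sym i p q : edge i p q -> edge i q p.
Proof.
by case: i => -[u [v [-> -> uv]]]; exists v, u; split=> //; exact: same_block_sym.
Qed.

Let edge_pedge p q : pedge a b p q -> exists i, edge i p q.
Proof. by case=> u v uv; [exists true|exists false]; exists u, v. Qed.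

Let edge_match i p q r : edge i p q -> edge i p r -> p = q \/ q = r \/ p = r.
Proof.
have lI : injective (@lower_to_middle X) by move=> [] x [] y //= [->].
have uI : injective (@upper_to_middle X) by move=> [] x [] y //= [->].
case: i => -[u [v [-> -> uv]]].
  move=> [u' [w [/lI <- -> uw]]].
  by have /(_ _ _ _ uv uw)[->|[->|->]] := elimT (partial_brauerP a) a2; auto.
move=> [u' [w [/uI <- -> uw]]].
by have /(_ _ _ _ uv uw)[->|[->|->]] := elimT (partial_brauerP b) b2; auto.
Qed.

Let colour u := if u is inl _ then true else false.

Let edge_outer i u q : edge i (outer u) q -> i = colour u.
Proof. by case: u => x; case: i => // -[[] ? [[] ? []]]. Qed.

Inductive walk u : nat -> bool -> pvertex X -> Prop :=
  | walk0 : walk u 0 (colour u) (outer u)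
  | walkS n i p q : walk u n i p -> edge i p q -> p <> q -> walk u n.+1 (~~ i) q.

Let walk_inj u n i p j q : walk u n i p -> walk u n j q -> i = j /\ p = q.
Proof.
move=> up; elim: up j q => {n i p} [j q|n i p p' up IH pp' np j q] uq.
  by inversion uq.
inversion uq as [|m k r q' ur rq' nr]; subst.
have [ik pr] := IH _ _ ur; subst k r; split=> //.
by have [|[|]] := edge_match pp' rq'.
Qed.

Let walk_conn u p : connected_by (pedge a b) (outer u) p ->
  exists n i, walk u n i p.
Proof.
suff H x y : pedge a b x y -> (exists n i, walk u n i x) ->
    exists n i, walk u n i y.
  move=> up.
  apply: (conn_closed (P := fun x => exists n i, walk u n i x) _ up);
    last by exists 0, (colour u); left.
  move=> x y xy; split; apply: H => //.
  by case: xy => ? ? /same_block_sym; [left|right].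
move=> /edge_pedge[j xy] [n [i ux]].
have [<-|nxy] := pselect (x = y); first by exists n, i.
have [E|ij] := eqVneq i j; first by exists n.+1, (~~ i); apply: (walkS ux); rewrite ?E.
move: ij xy nxy; case: ux => {n i x} [|n i z x uz zx nzx] ij xy nxy.
  by move: ij; rewrite (edge_outer xy) eqxx.
have E : j = i by move: ij; case: (i); case: (j).
subst j.
have [/esym/nzx|[zy|/nxy]] // := edge_match (edge_sym zx) xy.
by exists n, i; rewrite -zy.
Qed.

Let walk_stop u n i v m j p : outer v <> outer u ->
  walk u n i (outer v) -> walk u m j p -> m <= n.
Proof.
move=> vu uv up; have [//|nm] := leqP m n.
have {up p m j nm}[k [q uq]] : exists k q, walk u n.+1 k q.
  elim: m j p up nm => // m IH j p up.
  rewrite ltnS leq_eqVlt => /orP[/eqP E|nm]; first by subst m; exists j, p.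
  by inversion up as [|m' i' p' q' up']; subst; exact: IH up' nm.
inversion uq as [|n' i' p' q' up' pq' np']; subst.
have [E1 E2] := walk_inj uv up'; subst.
have Ei := edge_outer pq'.
inversion uv as [E0 E1 E2|n'' j p'' q'' up'' pq'' np'' E0 E1 E2].
  by case: vu.
by move: E1; rewrite Ei -(edge_outer (edge_sym pq'')); case: (j).
Qed.

Lemma partial_brauer_mul : pmul a b \in @partial_brauer X.
Proof.
have oI : injective (@outer X) by move=> [] x [] y //= [->].
apply/partial_brauerP => u v w /same_block_mul/walk_conn[n [i uv]].
move=> /same_block_mul/walk_conn[m [j uw]].
have [vu|nvu] := pselect (u = v); first by left.
have [wu|nwu] := pselect (u = w); first by right; right.
right; left; apply: (oI).
have E : n = m.
  by apply/eqP; rewrite eqn_leq; apply/andP; split;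
    [apply: walk_stop uw uv|apply: walk_stop uv uw] => /oI/esym.
by subst m; case: (walk_inj uv uw).
Qed.

End PartialBrauerMul.

Lemma partial_brauer_closed (X : Type) : monoid_closed (@partial_brauer X).
Proof.
split; last exact: partial_brauer_mul.
apply/partial_brauerP => u v w /same_block_oneP uv /same_block_oneP.
by case: u uv => x; case: v => y /= ->; case: w => z /= ->; auto.
Qed.

Record PBmon (X : Type) := MkPBmon {
  PBmon_val :> Pmon X;
  _ : PBmon_val \in @partial_brauer X }.

HB.instance Definition _ (X : Type) := [isSub for @PBmon_val X].
HB.instance Definition _ (X : Type) := [Choice of PBmon X by <:].
HB.instance Definition _ (X : Type) :=
  SubChoice_isSubMonoid.Build (Pmon X) (@partial_brauer X) (PBmon X)
    (partial_brauer_closed X).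

Local Open Scope group_scope.

Definition is_identity (S : semigroupType) (e : S) : Prop :=
  forall x : S, e * x = x /\ x * e = x.

(* The adjoined element None is present only if S has no identity. *)
Definition S1 (S : semigroupType) : Type :=
  {o : option S | o = None -> ~ exists e : S, is_identity e}.

Definition act_r (S : semigroupType) (x : S) (s : S1 S) : S :=
  if sval s is Some c then x * c else x.

Definition act_l (S : semigroupType) (s : S1 S) (x : S) : S :=
  if sval s is Some c then c * x else x.

Definition diagonal_right_act_monogenic (S : semigroupType) : Prop :=
  exists u v : S, [set: S * S] = range (fun s : S1 S => (act_r u s, act_r v s)).

Definition diagonal_left_act_monogenic (S : semigroupType) : Prop :=
  exists u v : S, [set: S * S] = range (fun s : S1 S => (act_l s u, act_l s v)).

Section Diameter.
Variable S : semigroupType.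
Implicit Types (U : set (S * S)) (n : nat) (a b : S).

Definition equivalence (rho : set (S * S)) : Prop :=
  [/\ forall a, rho (a, a),
      forall a b, rho (a, b) -> rho (b, a) &
      forall a b c, rho (a, b) -> rho (b, c) -> rho (a, c)].

Definition right_congruence (rho : set (S * S)) : Prop :=
  equivalence rho /\ forall a b s, rho (a, b) -> rho (a * s, b * s).

Definition left_congruence (rho : set (S * S)) : Prop :=
  equivalence rho /\ forall a b s, rho (a, b) -> rho (s * a, s * b).

Definition right_generates_universal U : Prop :=
  smallest right_congruence U = [set: S * S].

Definition left_generates_universal U : Prop :=
  smallest left_congruence U = [set: S * S].

Inductive right_seq U : nat -> S -> S -> Prop :=
  | right_seq0 a : right_seq U 0 a a
  | right_seqS n u v (s : S1 S) b : U (u, v) \/ U (v, u) ->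
      right_seq U n (act_r v s) b -> right_seq U n.+1 (act_r u s) b.

Inductive left_seq U : nat -> S -> S -> Prop :=
  | left_seq0 a : left_seq U 0 a a
  | left_seqS n u v (s : S1 S) b : U (u, v) \/ U (v, u) ->
      left_seq U n (act_l s v) b -> left_seq U n.+1 (act_l s u) b.

Definition least (A : set nat) n : Prop := A n /\ lbound A n.

(* d_U(a, b) = n *)
Definition right_dist U a b n : Prop := least [set k | right_seq U k a b] n.

Definition left_dist U a b n : Prop := least [set k | left_seq U k a b] n.

(* D(U, S) = n; there is no such n when D(U, S) is infinite, and infinite values
   do not affect whether the minimum of the D(U, S) is a given n. *)
Definition right_diameter_wrt U n : Prop :=
  supremums [set k | exists a b, right_dist U a b k] n.

Definition left_diameter_wrt U n : Prop :=
  supremums [set k | exists a b, left_dist U a b k] n.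

Definition has_right_diameter n : Prop :=
  least [set k | exists U, [/\ finite_set U, right_generates_universal U &
                               right_diameter_wrt U k]] n.

Definition has_left_diameter n : Prop :=
  least [set k | exists U, [/\ finite_set U, left_generates_universal U &
                               left_diameter_wrt U k]] n.

End Diameter.

(* Main.v *)
Require Import Defs.
From mathcomp Require Import all_boot all_order.
From mathcomp Require Import boolp classical_sets functions cardinality.

(** An infinite set [X] contains five disjoint copies of itself: [F], [P] and
    [G], [Q], which hold the upper and lower points of two partitions [a] and
    [b], and [H], which holds one point for each lower point of the result.
    Let [c] copy the blocks of [a] onto its upper points in [F] and [P], copy
    those of [b] onto its upper points in [G] and [Q], and join the point of
    [H] indexed by [x] to [x'].  Let [u] join [x] to the lower point of [F]
    indexed by [x], join the lower points of [H] and [P] that have the same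
    index, and leave all other points alone.  In the product graph of [u] and
    [c] the upper points are then wired to the [F] part of the copy of [a] and
    the lower points, through [H], to its [P] part, while the copy of [b] is
    cut off; hence [u c = a].  If [v] is built in the same way from [G] and [Q]
    then [v c = b].  Since [u] and [v] do not depend on [a] and [b], the pair
    [(u, v)] generates the diagonal right act.  The blocks of [u] and [v] have
    at most two points, and so do those of [c] if this holds for [a] and [b],
    so that one construction settles both monoids
    ([simultaneous_right_quotients]).  Exchanging [X] and [X'] is an
    anti-automorphism that preserves block sizes, which gives the left acts.

    For the diameter, let [(u, v)] generate the diagonal right act of a
    semigroup.  Any [(a, b)] is [(u s, v s)] for some [s], a sequence of length
    one over the single pair [(u, v)]; and in a semigroup with at least two
    elements length zero is not enough ([diameter1]).

    The five copies come from an injection of [X * nat] into [X]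
    ([infinite_inj_prod_nat]), which Zorn's lemma provides. *)

Set Implicit Arguments.
Unset Strict Implicit.
Unset Printing Implicit Defensive.

Local Open Scope classical_set_scope.

(** * Infinite sets absorb countable multiples *)

(** A maximal family of sequences with pairwise disjoint ranges leaves only a
    finite part of [X] uncovered, since an infinite remainder would contain a
    further sequence.  So each point of [X] is coded by a member of the family
    and a natural number, and in the second component there is room for one
    more natural number. *)
Lemma infinite_inj_prod_nat (X : Type) :
  infinite_set [set: X] -> exists g : X * nat -> X, injective g.
Proof.
elim/Ppointed: X => X infX; first by case: infX; rewrite emptyE.
pose sep (F : set (nat -> X)) :=
  forall f g m n, F f -> F g -> f m = g n -> f = g /\ m = n.
have [|F [sepF maxF]] := @Zorn_bigcup _ sep.
  move=> C Csep Ctot f g m n [A CA Af] [B CB Bg].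
  have [AB|BA] := Ctot _ _ CA CB.
    exact: (Csep _ CB) (AB _ Af) Bg.
  exact: (Csep _ CA) Af (BA _ Bg).
pose U := [set x | exists f n, F f /\ f n = x].
have finU : finite_set (~` U).
  apply: contrapT => /infiniteP/pcard_leP/injfunPex[h hU hI].
  have hI' m n : h m = h n -> m = n by apply: hI; rewrite inE.
  have hU' n : ~ U (h n) by apply: hU.
  apply: (maxF (F `|` [set h])).
    split=> [f Ff|sub]; first by left.
    by apply: (hU' 0); exists h, 0; split=> //; apply: sub; right.
  move=> f g m n [Ff|->] [Fg|->] E.
  - exact: sepF E.
  - by case: (hU' n); exists f, m.
  - by case: (hU' m); exists g, n.
  - by split=> //; apply: hI'.
have [f0 Ff0] : exists f, F f.
  apply: contrapT => F0; apply: infX; apply: sub_finite_set finU => x _.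
  by move=> [f [n [Ff _]]]; apply: F0; exists f.
have /pcard_injP[e eI] : (~` U #<= [set: nat])%card.
  exact: finite_set_countable.
(* Covered points get even numbers; the finitely many others are numbered by
   odd numbers along one fixed sequence. *)
have /choice[d dP] x : exists d : (nat -> X) * nat, F d.1 /\
    ((U x /\ exists2 n, d.2 = n.*2 & d.1 n = x) \/
     (~ U x /\ d = (f0, (e x).*2.+1))).
  have [Ux|nUx] := pselect (U x); last by exists (f0, (e x).*2.+1); split; auto.
  have [f [n [Ff fn]]] := Ux.
  by exists (f, n.*2); split=> //; left; split=> //; exists n.
have dI : injective d.
  move=> x y E; have [_ dx] := dP x; have [_ dy] := dP y.
  case: dx dy => [[_ [m dm <-]]|[nUx dx]] [[_ [n dn <-]]|[nUy dy]].
  - by move: dm; rewrite E dn => /double_inj->.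
  - by move: dm; rewrite E dy /= => /(congr1 odd); rewrite /= !odd_double.
  - by move: dn; rewrite -E dx /= => /(congr1 odd); rewrite /= !odd_double.
  - by move: E; rewrite dx dy => -[/double_inj] exy; apply: eI; rewrite ?inE.
exists (fun t => (d t.1).1 (pickle ((d t.1).2, t.2))) => -[x m] [y n] /= E.
have [E1 /(pcan_inj pickleK)[E2 ->]] := sepF _ _ _ _ (dP x).1 (dP y).1 E.
by rewrite (dI x y) //; move: (d x) (d y) E1 E2 => [? ?] [? ?] /= -> ->.
Qed.

Lemma partial_inverse (T U : Type) (j : T -> U) :
  injective j -> exists2 k : U -> option T, pcancel j k & ocancel k j.
Proof.
move=> jI.
have /choice[k kP] y : exists o, if o is Some t then j t = y
                                 else forall t, j t <> y.
  have [[t jt]|nj] := pselect (exists t, j t = y); first by exists (Some t).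
  by exists None => t jt; apply: nj; exists t.
exists k => [t|y]; last by move: (kP y); case: (k y).
by move: (kP (j t)); case: (k (j t)) => [s /jI->|/(_ t)].
Qed.

(** * Partitions given by labellings *)

Section Kernel.
Variables (X L : Type) (l : X + X -> L).

Lemma kernel_is_partition :
  partition (range (fun s => [set t | l s = l t])) id [set: X + X].
Proof.
split=> [|B C [s _ <-] [t _ <-] [w [/= sw tw]]|B [s _ <-]]; last by exists s.
  apply/seteqP; split=> // s _; by exists [set t | l s = l t]; [exists s|].
by rewrite sw tw.
Qed.

Definition kernel_partition : Pmon X := MkPmon kernel_is_partition.

Lemma same_block_kernel s t : same_block kernel_partition s t <-> l s = l t.
Proof.
split=> [[B [w _ <-] [/= <- <-]] //|st].
by exists [set t | l s = l t]; [exists s|].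
Qed.

(** Each fibre of the labelling has at most the two points that [p] and [q] assign
    to its label. *)
Lemma kernel_partial_brauer (p q : L -> X + X) :
  (forall s, s = p (l s) \/ s = q (l s)) ->
  kernel_partition \in @partial_brauer X.
Proof.
move=> pq; apply/partial_brauerP => s t w.
move=> /same_block_kernel st /same_block_kernel sw.
have := pq s; have := pq t; have := pq w; rewrite -st -sw; move: (l s) => d.
by case=> ->; case=> ->; case=> ->; auto.
Qed.

End Kernel.

(** The set [same_block a s] is the block of [s], so it can serve as a label. *)
Lemma eq_same_block (X : Type) (a : Pmon X) s t :
  same_block a s = same_block a t <-> same_block a s t.
Proof.
split=> [->|st]; first exact: same_block_refl.
apply/funext => w; rewrite propeqE; split; last exact: same_block_trans.
by apply: same_block_trans; exact: same_block_sym.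
Qed.

(** * Recovering two partitions from one by multiplication *)

(** The injection [j] packs into [X] a copy of [X + X] for each of the two
    partitions [p false] and [p true], and one further copy of [X]; [k] decodes
    the points of [X]. *)
Section Multiplexer.
Variables (X : Type) (j : bool * (X + X) + X -> X).
Variable k : X -> option (bool * (X + X) + X).
Hypotheses (jK : pcancel j k) (kK : ocancel k j).
Implicit Types (i : bool) (p : bool -> Pmon X) (x y : X) (s t w : X + X).

(** The label [inl s] marks the at most two points of the selector wired to the
    outer point [s] of the product; [inr y] marks an isolated lower point. *)
Definition selector_label i w : (X + X) + X :=
  match w with
  | inl x => inl (inl x)
  | inr y => match k y with
             | Some (inl (i', s)) => if i' == i then inl s else inr y
             | Some (inr x) => inl (inr x)
             | None => inr y
             end
  end.

Definition selector i : Pmon X := kernel_partition (selector_label i).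

(** An upper point that codes a point of [p i] is labelled by its block, with the
    tag [i] keeping the two copies apart; a point of the last copy of [X] is
    joined to the lower point that it codes. *)
Definition bundle_label p w : bool * set (X + X) + (X + X) :=
  match w with
  | inl y => match k y with
             | Some (inl (i, s)) => inl (i, same_block (p i) s)
             | Some (inr x) => inr (inr x)
             | None => inr (inl y)
             end
  | inr x => inr (inr x)
  end.

Definition bundle p : Pmon X := kernel_partition (bundle_label p).

(** The points with label [inl s] are the packed copy of [s] and either [s]
    itself, for an upper point, or the code of [s] in the last copy of [X]. *)
Lemma selector_partial_brauer i : selector i \in @partial_brauer X.
Proof.
pose first (d : (X + X) + X) : X + X := match d with
  | inl (inl x) => inl x | inl (inr x) => inr (j (inr x)) | inr y => inr y end.
pose second (d : (X + X) + X) : X + X :=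
  match d with inl s => inr (j (inl (i, s))) | inr y => inr y end.
apply: (@kernel_partial_brauer _ _ _ first second) => -[x|y]; first by left.
rewrite /=; case: (k y) (kK y) => [[[i' s]|x] /= <-|_]; try by left.
by case: eqP => [->|_]; [right|left].
Qed.

(** The blocks of the bundle are copies of blocks of the [p i], pairs consisting
    of a code and a lower point, and isolated points. *)
Lemma bundle_partial_brauer p :
  (forall i, p i \in @partial_brauer X) -> bundle p \in @partial_brauer X.
Proof.
move=> p2.
have cases w : [\/ exists i s, w = inl (j (inl (i, s))),
    exists x, w = inl (j (inr x)), exists2 y, w = inl y & k y = None |
    exists x, w = inr x].
  case: w => [y|x]; last by constructor 4; exists x.
  move: (kK y); case E: (k y) => [[[i s]|x]|] /= jy; rewrite -?jy.
  - by constructor 1; exists i, s.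
  - by constructor 2; exists x.
  - by constructor 3; exists y.
apply/partial_brauerP => s t w /same_block_kernel st /same_block_kernel sw.
case: (cases s) (cases t) (cases w) st sw =>
  [[i [s' ->]]|[x ->]|[y -> ky]|[x ->]] [[i1 [t' ->]]|[x1 ->]|[y1 -> ky1]|[x1 ->]]
  [[i2 [w' ->]]|[x2 ->]|[y2 -> ky2]|[x2 ->]]; rewrite /= ?jK ?ky ?ky1 ?ky2 => // st sw.
  case: st sw => <- /eq_same_block st; case=> <- /eq_same_block sw.
  by have [->|[->|->]] := elimT (partial_brauerP (p i)) (p2 i) _ _ _ st sw; auto.
all: by case: st sw => -> [->]; auto.
Qed.

(** The selector attaches every outer point to its copy in [p i], so points in a
    common block of [p i] are connected.  Conversely, sending each vertex of the
    product graph to the block of [p i] that it is wired to, and all the vertices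
    that are cut off to one extra value, is constant along edges. *)
Lemma selector_bundle p i : pmul (selector i) (bundle p) = p i.
Proof.
apply: Pmon_eq => s t; rewrite same_block_mul; split.
  (* Constancy along the edges holds because [view], restricted to either half of
     the graph, factors through the labelling of that half. *)
  pose view (d : pvertex X) : option (set (X + X)) := match d with
    | Upper x => Some (same_block (p i) (inl x))
    | Middle y => match k y with
                  | Some (inl (i', s)) =>
                      if i' == i then Some (same_block (p i) s) else None
                  | Some (inr x) => Some (same_block (p i) (inr x))
                  | None => None
                  end
    | Lower x => Some (same_block (p i) (inr x))
    end.
  move=> st; suff : view (outer s) = view (outer t).
    by case: s {st} => ?; case: t => ? /= [/eq_same_block].
  apply: (@conn_min _ _ (fun c d => view c = view d)) st => //.
    by move=> ? ? ? -> ->.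
  move=> _ _ [{}s {}t /same_block_kernel st|{}s {}t /same_block_kernel st].
    have E w : view (lower_to_middle w) =
        if selector_label i w is inl r then Some (same_block (p i) r) else None.
      case: w => //= y; case: (k y) => [[[i' r]|x]|] //.
      by case: eqP.
    by rewrite !E st.
  have E w : view (upper_to_middle w) = match bundle_label p w with
      | inl (i', B) => if i' == i then Some B else None
      | inr (inr x) => Some (same_block (p i) (inr x))
      | inr (inl _) => None
      end.
    case: w => //= y; case: (k y) => [[[i' r]|x]|] //=.
    by case: eqP => [->|].
  by rewrite !E st.
have outside w : connected_by (pedge (selector i) (bundle p))
    (outer w) (Middle (j (inl (i, w)))).
  case: w => x.
    apply: connE; apply: (@pedge_down _ _ _ (inl x) (inr _)).
    by apply/same_block_kernel; rewrite /= jK eqxx.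
  apply: (@connT _ _ (Middle (j (inr x)))); apply: connE.
    apply: (@pedge_up _ _ _ (inr x) (inl _)).
    by apply/same_block_kernel; rewrite /= jK.
  apply: (@pedge_down _ _ _ (inr _) (inr _)).
  by apply/same_block_kernel; rewrite /= !jK eqxx.
move=> st; apply: connT (outside s) (connT _ (connS (outside t))).
apply: connE; apply: (@pedge_up _ _ _ (inl _) (inl _)).
by apply/same_block_kernel; rewrite /= !jK; congr (inl (i, _)); apply/eq_same_block.
Qed.

End Multiplexer.

(** The factors [u] and [v] are chosen before [a] and [b], and the last clause
    lets the same [c] serve inside the partial Brauer monoid. *)
Lemma simultaneous_right_quotients (X : Type) : infinite_set [set: X] ->
  exists u v : Pmon X,
  [/\ u \in @partial_brauer X, v \in @partial_brauer X &
      forall a b, exists c, [/\ pmul u c = a, pmul v c = b &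
        a \in @partial_brauer X -> b \in @partial_brauer X ->
        c \in @partial_brauer X]].
Proof.
move=> /infinite_inj_prod_nat[g gI].
pose j (d : bool * (X + X) + X) : X := g (match d with
  | inl (false, inl x) => (x, 0) | inl (false, inr x) => (x, 1)
  | inl (true, inl x) => (x, 2) | inl (true, inr x) => (x, 3)
  | inr x => (x, 4) end).
have /partial_inverse[k jK kK] : injective j.
  by move=> [[[] []]|] ? [[[] []]|] ? /gI // [->].
exists (selector k false), (selector k true).
split=> [||a b]; do ?exact: selector_partial_brauer kK _.
pose p i := if i then b else a.
exists (bundle k p); split=> [||a2 b2].
- exact: (selector_bundle jK p false).
- exact: (selector_bundle jK p true).
- by apply: (bundle_partial_brauer jK kK) => -[].
Qed.

(** * The duality that exchanges the two copies of the set *)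

Section Dual.
Variable X : Type.
Implicit Types (a b : Pmon X) (s t : X + X).

Definition swap s : X + X := match s with inl x => inr x | inr x => inl x end.

Definition pdual a : Pmon X := kernel_partition (fun s => same_block a (swap s)).

Lemma same_block_dual a s t :
  same_block (pdual a) s t <-> same_block a (swap s) (swap t).
Proof. by rewrite same_block_kernel eq_same_block. Qed.

Lemma swapK : involutive swap. Proof. by case. Qed.

Lemma pdualK : involutive pdual.
Proof. by move=> a; apply: Pmon_eq => s t; rewrite !same_block_dual !swapK. Qed.

(** Turning the product graph upside down sends edges to edges.  This gives one
    inclusion for all factors, and the other follows as duality is an
    involution. *)
Lemma pdual_mul a b : pdual (pmul a b) = pmul (pdual b) (pdual a).
Proof.
have sub c d s t : same_block (pmul c d) s t ->
    same_block (pmul (pdual d) (pdual c)) (swap s) (swap t).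
  pose flip (e : pvertex X) := match e with
    | Upper x => Lower x | Middle x => Middle x | Lower x => Upper x end.
  have outE w : outer (swap w) = flip (outer w) by case: w.
  rewrite !same_block_mul !outE; apply: conn_map => _ _ [u v uv|u v uv].
    have E w : flip (lower_to_middle w) = upper_to_middle (swap w) by case: w.
    by rewrite !E; apply/connE/pedge_up/same_block_dual; rewrite !swapK.
  have E w : flip (upper_to_middle w) = lower_to_middle (swap w) by case: w.
  by rewrite !E; apply/connE/pedge_down/same_block_dual; rewrite !swapK.
apply: Pmon_eq => s t; rewrite same_block_dual; split.
  by move/sub; rewrite !swapK.
by move/sub; rewrite !pdualK.
Qed.

Lemma pdual_partial_brauer a :
  a \in @partial_brauer X -> pdual a \in @partial_brauer X.
Proof.
move=> /partial_brauerP a2; apply/partial_brauerP => s t w.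
move=> /same_block_dual st /same_block_dual sw.
by case: (a2 _ _ _ st sw) => [|[]] /(can_inj swapK); auto.
Qed.

End Dual.

Lemma simultaneous_left_quotients (X : Type) : infinite_set [set: X] ->
  exists u v : Pmon X,
  [/\ u \in @partial_brauer X, v \in @partial_brauer X &
      forall a b, exists c, [/\ pmul c u = a, pmul c v = b &
        a \in @partial_brauer X -> b \in @partial_brauer X ->
        c \in @partial_brauer X]].
Proof.
move=> /simultaneous_right_quotients[u [v [u2 v2 uv]]].
exists (pdual u), (pdual v); split; do ?exact: pdual_partial_brauer.
move=> a b; have [c [ca cb c2]] := uv (pdual a) (pdual b).
exists (pdual c); rewrite -!pdual_mul ca cb !pdualK; split=> // a2 b2.
by apply: pdual_partial_brauer; apply: c2; exact: pdual_partial_brauer.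
Qed.

(** The partition into singletons differs from the identity. *)
Lemma partial_brauer_nontrivial (X : Type) : infinite_set [set: X] ->
  exists2 a : Pmon X, a \in @partial_brauer X & a <> pone X.
Proof.
move=> /infinite_setN0[x _]; exists (kernel_partition id).
  by apply: (@kernel_partial_brauer _ _ _ id id); left.
by move=> E; have := same_block_one x; rewrite -E => /same_block_kernel.
Qed.

(** * Semigroups with monogenic diagonal acts have diameter one *)

Section MonogenicDiameter.
Variable S : semigroupType.
Implicit Types (U : set (S * S)) (a b u v : S).

Lemma S1_one : exists e : S1 S, forall a : S, act_r a e = a /\ act_l e a = a.
Proof.
have [[e eP]|no_one] := pselect (exists e : S, is_identity e).
  have h : Some e = None -> ~ exists e : S, is_identity e by [].
  by exists (exist _ (Some e) h) => a; have [] := eP a.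
by exists (exist _ None (fun=> no_one)).
Qed.

Lemma S1_lift (c : S) : exists s : S1 S,
  forall a, act_r a s = (a * c)%g /\ act_l s a = (c * a)%g.
Proof.
have h : Some c = None -> ~ exists e : S, is_identity e by [].
by exists (exist _ (Some c) h).
Qed.

(** The part of the argument that does not depend on the side: [gen] and [chain]
    stand for generation of the universal relation and for sequences of given
    length.  A generating set must contain a pair of distinct elements, and such
    a pair is at distance exactly one; so the diameter is never zero. *)
Lemma diameter1 (gen : set (set (S * S)))
    (chain : set (S * S) -> nat -> S -> S -> Prop) :
  (forall U a b, chain U 0 a b <-> a = b) ->
  (forall U a b, U (a, b) -> chain U 1 a b) ->
  (forall U, gen U -> exists a b, a <> b /\ U (a, b)) ->
  (exists U, [/\ finite_set U, gen U & forall a b, chain U 1 a b]) ->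
  least [set n | exists U, [/\ finite_set U, gen U & supremums
    [set k | exists a b, least [set m | chain U m a b] k] n]] 1.
Proof.
move=> chain0 chain1 genN [U0 [finU0 genU0 U01]].
have dist1 U a b : a <> b -> chain U 1 a b -> least [set m | chain U m a b] 1.
  by move=> ab ch; split=> // -[] // /chain0.
split.
  exists U0; split=> //; split.
    by move=> k [a [b [_ lbk]]]; apply: lbk; exact: U01.
  move=> n ubn; have [a [b [ab _]]] := genN _ genU0.
  by apply: ubn; exists a, b; exact: dist1.
move=> n [U [_ genU [ubn _]]]; have [a [b [ab Uab]]] := genN _ genU.
by apply: ubn; exists a, b; apply: dist1 => //; exact: chain1.
Qed.

(** Equality is a right congruence, so generators inside it generate the
    universal relation only if all elements are equal. *)
Lemma right_diameter1 : (exists a b, a <> b) ->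
  diagonal_right_act_monogenic S -> has_right_diameter S 1.
Proof.
move=> [a0 [b0 ab0]] [u [v uv]]; have [e eP] := S1_one.
have uvP a b : exists s, act_r u s = a /\ act_r v s = b.
  have : [set: S * S] (a, b) by []. by rewrite uv => -[s _ [<- <-]]; exists s.
apply: (@diameter1 (@right_generates_universal S) (@right_seq S)).
- move=> U a b; split=> [ab|->]; last exact: right_seq0.
  by inversion ab.
- move=> U a b Uab; rewrite -(eP a).1.
  apply: (@right_seqS _ _ _ _ b); first by left.
  by rewrite (eP b).1; exact: right_seq0.
- move=> U genU; apply: contrapT => noU; apply: ab0.
  have : [set: S * S] (a0, b0) by [].
  rewrite -genU => /(_ [set d | d.1 = d.2]); apply; split.
    by split=> [|a b c /= ->]; first by split=> //= ? ? ? -> ->.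
  by move=> [a b] Uab /=; apply: contrapT => ab; apply: noU; exists a, b.
- exists [set (u, v)]; split; first exact: finite_set1.
    apply/seteqP; split=> // -[a b] _ rho [[_ act] sub].
    have [[[c|] h] [<- <-]] := uvP a b; rewrite /act_r /=.
      by apply: act; apply: sub.
    exact: sub.
  move=> a b; have [s [<- <-]] := uvP a b.
  by apply: (@right_seqS _ _ _ _ v); [left|exact: right_seq0].
Qed.

Lemma left_diameter1 : (exists a b, a <> b) ->
  diagonal_left_act_monogenic S -> has_left_diameter S 1.
Proof.
move=> [a0 [b0 ab0]] [u [v uv]]; have [e eP] := S1_one.
have uvP a b : exists s, act_l s u = a /\ act_l s v = b.
  have : [set: S * S] (a, b) by []. by rewrite uv => -[s _ [<- <-]]; exists s.
apply: (@diameter1 (@left_generates_universal S) (@left_seq S)).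
- move=> U a b; split=> [ab|->]; last exact: left_seq0.
  by inversion ab.
- move=> U a b Uab; rewrite -(eP a).2.
  apply: (@left_seqS _ _ _ _ b); first by left.
  by rewrite (eP b).2; exact: left_seq0.
- move=> U genU; apply: contrapT => noU; apply: ab0.
  have : [set: S * S] (a0, b0) by [].
  rewrite -genU => /(_ [set d | d.1 = d.2]); apply; split.
    by split=> [|a b c /= ->]; first by split=> //= ? ? ? -> ->.
  by move=> [a b] Uab /=; apply: contrapT => ab; apply: noU; exists a, b.
- exists [set (u, v)]; split; first exact: finite_set1.
    apply/seteqP; split=> // -[a b] _ rho [[_ act] sub].
    have [[[c|] h] [<- <-]] := uvP a b; rewrite /act_l /=.
      by apply: act; apply: sub.
    exact: sub.
  move=> a b; have [s [<- <-]] := uvP a b.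
  by apply: (@left_seqS _ _ _ _ v); [left|exact: left_seq0].
Qed.

Lemma right_monogenic u v :
  (forall a b, exists c, (u * c)%g = a /\ (v * c)%g = b) ->
  diagonal_right_act_monogenic S.
Proof.
move=> uv; exists u, v; apply/seteqP; split=> // -[a b] _.
have [c [<- <-]] := uv a b; have [s sP] := S1_lift c.
by exists s => //; rewrite (sP u).1 (sP v).1.
Qed.

Lemma left_monogenic u v :
  (forall a b, exists c, (c * u)%g = a /\ (c * v)%g = b) ->
  diagonal_left_act_monogenic S.
Proof.
move=> uv; exists u, v; apply/seteqP; split=> // -[a b] _.
have [c [<- <-]] := uv a b; have [s sP] := S1_lift c.
by exists s => //; rewrite (sP u).2 (sP v).2.
Qed.

End MonogenicDiameter.

Theorem theorem5p1 (X : Type) (infX : infinite_set [set: X]) :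
  [/\ diagonal_right_act_monogenic (Pmon X),
      diagonal_left_act_monogenic (Pmon X),
      diagonal_right_act_monogenic (PBmon X) &
      diagonal_left_act_monogenic (PBmon X)] /\
  [/\ has_right_diameter (Pmon X) 1,
      has_left_diameter (Pmon X) 1,
      has_right_diameter (PBmon X) 1 &
      has_left_diameter (PBmon X) 1].
Proof.
have [u [v [u2 v2 uv]]] := simultaneous_right_quotients infX.
have [u' [v' [u'2 v'2 uv']]] := simultaneous_left_quotients infX.
have [z z2 z1] := partial_brauer_nontrivial infX.
have PN : exists a b : Pmon X, a <> b by exists z, (pone X).
have PBN : exists a b : PBmon X, a <> b.
  by exists (MkPBmon z2), 1%g => /(congr1 (@PBmon_val X)).
have Pr : diagonal_right_act_monogenic (Pmon X).
  by apply: (@right_monogenic _ u v) => a b; have [c []] := uv a b; exists c.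
have Pl : diagonal_left_act_monogenic (Pmon X).
  by apply: (@left_monogenic _ u' v') => a b; have [c []] := uv' a b; exists c.
have PBr : diagonal_right_act_monogenic (PBmon X).
  apply: (@right_monogenic _ (MkPBmon u2) (MkPBmon v2)) => a b.
  have [c [ca cb c2]] := uv a b.
  by exists (MkPBmon (c2 (valP a) (valP b))); split; apply: val_inj.
have PBl : diagonal_left_act_monogenic (PBmon X).
  apply: (@left_monogenic _ (MkPBmon u'2) (MkPBmon v'2)) => a b.
  have [c [ca cb c2]] := uv' a b.
  by exists (MkPBmon (c2 (valP a) (valP b))); split; apply: val_inj.
split; split=> //;
  by [exact: right_diameter1 PN Pr|exact: left_diameter1 PN Pl
     |exact: right_diameter1 PBN PBr|exact: left_diameter1 PBN PBl].
Qed.
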